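(* Let $R$ be a (left and right) noetherian prime ring such that the abelian group $(R,+)$ is torsion free. Let $n\ge 1$ and let $S = R[x_1,\delta_1,x_2,\delta_2,\dots,x_n,\delta_n]$ be a ring of iterated differential polynomials over $R$ which satisfies: (a) $\delta_i(R) \subseteq R$ for every $i = 1,\dots,n$; (b) $\delta_i(x_j) \in R[x_1,\dots,x_j]$ for every $1 \leq j < i \leq n$; (c) if $J$ is a two-sided ideal of $R$ such that $\delta_i(J) \subseteq J$ for every $i = 1,\dots,n$, then $J = 0$ or $J = R$. Then $I(n) = 0$ for every proper two-sided ideal $I$ of $S$.
   Context: Rings are associative with unit; ''ideal'' means two-sided ideal. For an ideal $I$ of a ring, $I(1) := \bigcap_{k\in\mathbb{N}} I^k$, and inductively $I(m) := (I(m-1))(1)$ for $m\ge 2$. A derivation on a ring $R$ is an additive map $\delta\colon R\to R$ with $\delta(rs)=\delta(r)s+r\delta(s)$ for all $r,s\in R$. The ring of differential polynomials $R[x,\delta]$ is the free left $R$-module with basis $1,x,x^2,\dots$ with multiplication determined by $xr-rx=\delta(r)$ for $r\in R$. A ring of iterated differential polynomials $S=R[x_1,\delta_1,\dots,x_n,\delta_n]$ over $R$ is obtained by iterating this construction: put $R_0=R$ and, for $0\le i<n$, let $\delta_{i+1}$ be a derivation on $R_i$ and $R_{i+1}=R_i[x_{i+1},\delta_{i+1}]$; then $S=R_n$. The subring $R_i$ of $S$ (generated by $R$ and $x_1,\dots,x_i$) is denoted $R[x_1,\dots,x_i]$. *)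

(* Defs.v *)
From HB Require Import structures.
From mathcomp Require Export all_boot all_order all_algebra.
From mathcomp Require Export mathcomp_extra boolp classical_sets.

Set Implicit Arguments.
Unset Strict Implicit.
Unset Printing Implicit Defensive.

Import GRing.Theory.
Local Open Scope classical_set_scope.
Local Open Scope ring_scope.

Section Ideals.
Variable R : nzRingType.
Implicit Types I J : set R.

(* Closure under opposites follows from multiplication by -1. *)
Definition left_ideal I :=
  [/\ I 0, forall a b, I a -> I b -> I (a + b) & forall r a, I a -> I (r * a)].

Definition right_ideal I :=
  [/\ I 0, forall a b, I a -> I b -> I (a + b) & forall r a, I a -> I (a * r)].

Definition ideal I := left_ideal I /\ right_ideal I.

Definition proper_ideal I := ideal I /\ I <> setT.

Definition ideal_mul I J : set R :=
  [set s | exists (m : nat) (a b : 'I_m -> R),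
     (forall i, I (a i) /\ J (b i)) /\ s = \sum_(i < m) a i * b i].

Definition ideal_exp I (k : nat) : set R := iter k (ideal_mul I) setT.

(* The factor k = 0 is the whole ring, so it does not affect the intersection,
   and [ideal_exp I 1 = I] for an ideal [I]. *)
Definition ideal_cap I : set R := \bigcap_k ideal_exp I k.

(* I(m), extended by I(0) = I. *)
Definition ideal_itercap I (m : nat) : set R := iter m ideal_cap I.

Definition acc (C : set R -> Prop) :=
  forall J : nat -> set R, (forall k, C (J k)) ->
    (forall k, J k `<=` J k.+1) ->
    exists N, forall k, (N <= k)%N -> J k = J N.

Definition noetherian := acc left_ideal /\ acc right_ideal.

(* The ring is nonzero since [R : nzRingType]. *)
Definition prime_ring := forall I J, ideal I -> ideal J ->
  ideal_mul I J = [set 0] -> I = [set 0] \/ J = [set 0].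

Definition torsion_free := forall (r : R) (m : nat), r *+ m.+1 = 0 -> r = 0.

End Ideals.

Section DifferentialPolynomials.
Variable S : nzRingType.
Implicit Types A B : set S.

(* The values of [d] outside the subring [A] are irrelevant. *)
Definition derivation_on A (d : S -> S) :=
  [/\ forall a, A a -> A (d a),
      forall a b, A a -> A b -> d (a + b) = d a + d b
    & forall a b, A a -> A b -> d (a * b) = d a * b + a * d b].

(* B = A[x, d] inside S: [p.[x]] is the sum of the [p`_k * x ^+ k], so the last
   two clauses say that B is a free left A-module with basis the powers of x. *)
Definition diff_poly_ring A (d : S -> S) (x : S) B :=
  [/\ derivation_on A d,
      forall a, A a -> x * a - a * x = d a,
      B = [set p.[x] | p in [set p : {poly S} | forall k, A p`_k]]
    & forall p q : {poly S}, (forall k, A p`_k) -> (forall k, A q`_k) ->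
        p.[x] = q.[x] -> p = q].

(* R[x_1, .., x_i], generated by R and the first i of the variables. *)
Definition tower (R : nzRingType) (iota : R -> S) n (x : 'I_n -> S) (i : nat)
    : set S :=
  smallest (fun A => GRing.subring_closed [in A])
    (range iota `|` x @` [set j : 'I_n | (j < i)%N]).

(* S = R[x_1, d_1, .., x_n, d_n], with R identified with its image by [iota]
   and the indices starting from 0. *)
Definition iter_diff_poly_ring (R : nzRingType) (iota : {rmorphism R -> S})
    n (x : 'I_n -> S) (d : 'I_n -> S -> S) :=
  [/\ injective iota,
      forall i : 'I_n,
        diff_poly_ring (tower iota x i) (d i) (x i) (tower iota x i.+1)
    & tower iota x n = setT].

End DifferentialPolynomials.

(* Main.v *)
Require Import Defs.
From mathcomp Require Import zify.

Set Implicit Arguments.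
Unset Strict Implicit.
Unset Printing Implicit Defensive.

Import GRing.Theory.
Local Open Scope classical_set_scope.
Local Open Scope ring_scope.

(** The idea is to peel off the variables from the top. Write [T j] for the
    subring generated by [R] and the first [j] variables. The statement proved
    by induction on [j] is that [I(j) = 0] for every proper ideal [I] of [T j]
    which is stable under the derivations [delta i], [j <= i]; for [j = 0] this
    is the simplicity of [R], and for [j = n] no stability is asked for.

    For the step, let [A = T j], [B = T j.+1 = A[x, d]], and let [P] be a minimal
    prime over [I]. It is stable under the derivations under which [I] is: for a
    derivation [d] the elements of [P] all of whose iterated derivatives lie in
    [P] form an ideal [P'] over [I], and [P'] is prime because the expansion of
    [d ^ (k + l) (a b)] modulo [P], when [a] and [b] have orders [k] and [l],
    reduces to [binomial (k + l, k) * d ^ k (a) * d ^ l (b)]. The binomial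
    coefficient is invertible: [m R] is a stable ideal of [R], nonzero as [R] is
    torsion free, hence all of [R] ([exists_stable_prime], [tower_natr_inv]).

    Put [p = P n A], a proper ideal of [A] which is stable under the [delta i]
    with [j <= i] (for [i = j] because [d] is the commutator with [x]). The core
    of the proof is that the intersection of the powers of [P] lies in [p[x]]
    ([cap_prime]). Granting this, [I(j + 1)] lies in [p[x](j)], which lies in
    [p(j)[x]] since [p] is [d]-stable and the powers of [x] are independent over
    [A]; and [p(j) = 0] by induction.

    If [A / p] had a simple artinian ring of fractions, then over it the ideal
    [P / p[x]] would be generated by a central polynomial of positive degree, and
    the nonzero elements of its [k]-th power would have degree at least [k]. The
    proof of [cap_prime] obtains this degree estimate without fractions. Let [m]
    be the least degree of an element of [P] outside [p[x]] and [b] range over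
    the ideal of the coefficients of degree [m] of the elements of [P] of degree
    at most [m]. Modulo [p[x]] an element [q_b] of [P] with [q_b = b x ^ m + ...]
    is determined by [b], so that [a q_b = q_(a b)] and [q_b a = q_(b a)]. Thus
    [c e q_b = q_c e b], and the denominators introduced when dividing by the
    [q_b] may be moved through them ([pseudo_division]). They do no harm, since
    the ideal of the [b] is [d]-stable and hence, as [P] is prime, has no
    annihilator modulo [p] ([prime_annihilator]). *)

(** * Subrings and their ideals, as subsets of a fixed ring *)

Section Subsets.
Variable S : nzRingType.
Implicit Types (A B I J P X Y : set S) (d : S -> S).

Definition subgroup X := X 0 /\ forall a b, X a -> X b -> X (a - b).

Definition subring A := [/\ subgroup A, A 1 & forall a b, A a -> A b -> A (a * b)].

Definition ideal_in B I :=
  [/\ subgroup I, I `<=` B, forall r a, B r -> I a -> I (r * a)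
    & forall r a, B r -> I a -> I (a * r)].

Definition stable d X := forall a, X a -> X (d a).

Definition prime_in B P :=
  [/\ ideal_in B P, ~ P 1 &
      forall a b, B a -> B b -> (forall t, B t -> P (a * t * b)) -> P a \/ P b].

Lemma subgroup0 X : subgroup X -> X 0.
Proof. by case. Qed.

Lemma subgroupB X a b : subgroup X -> X a -> X b -> X (a - b).
Proof. by case=> _; apply. Qed.

Lemma subgroupN X a : subgroup X -> X a -> X (- a).
Proof. by move=> sX Xa; rewrite -sub0r; apply: subgroupB => //; case: sX. Qed.

Lemma subgroupD X a b : subgroup X -> X a -> X b -> X (a + b).
Proof. by move=> sX Xa Xb; rewrite -[b]opprK; do 2?apply: subgroupB => //; apply: subgroupN. Qed.

Lemma subgroup_sum X n (F : 'I_n -> S) :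
  subgroup X -> (forall i, X (F i)) -> X (\sum_i F i).
Proof.
move=> sX XF; elim/big_ind: _ => //; first by case: sX.
by move=> a b; apply: subgroupD.
Qed.

Lemma subgroupMn X a n : subgroup X -> X a -> X (a *+ n).
Proof.
move=> sX Xa; elim: n => [|n IHn]; first by case: sX.
by rewrite mulrS; apply: subgroupD.
Qed.

Lemma subgroup_mull X r : subgroup X -> subgroup [set u | X (r * u)].
Proof.
move=> sX; split=> [|u v Xu Xv]; rewrite /= ?mulr0 ?mulrBr; first by case: sX.
exact: subgroupB.
Qed.

Lemma subgroup_mulr X r : subgroup X -> subgroup [set u | X (u * r)].
Proof.
move=> sX; split=> [|u v Xu Xv]; rewrite /= ?mul0r ?mulrBl; first by case: sX.
exact: subgroupB.
Qed.

Lemma subrACA (V : zmodType) (a b u v : V) : a - b - (u - v) = (a - u) - (b - v).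
Proof. by rewrite (opprD u) addrACA -opprD. Qed.

Lemma subgroup_congr X a b : subgroup X -> X (a - b) -> X b -> X a.
Proof. by move=> sX Xab Xb; rewrite -(subrK b a); apply: subgroupD. Qed.

Section Derivation.
Variables (B : set S) (d : S -> S).
Hypotheses (sB : subring B) (dB : derivation_on B d).

Lemma derivation0 : d 0 = 0.
Proof.
have [[B0 _] _ _] := sB; case: dB => _ dD _.
by apply: (addrI (d 0)); rewrite -dD ?addr0.
Qed.

Lemma derivation1 : d 1 = 0.
Proof.
have [_ B1 _] := sB; case: dB => _ _ dM.
by apply: (addrI (d 1)); rewrite -{3}[1]mulr1 dM // mulr1 mul1r addr0.
Qed.

Lemma derivationN a : B a -> d (- a) = - d a.
Proof.
move=> Ba; have [sgB _ _] := sB; case: dB => _ dD _.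
by apply/eqP; rewrite -addr_eq0 -dD ?addNr ?derivation0 //; apply: subgroupN.
Qed.

Lemma derivationB a b : B a -> B b -> d (a - b) = d a - d b.
Proof.
move=> Ba Bb; have [sgB _ _] := sB; case: dB => _ dD _.
by rewrite dD ?derivationN //; apply: subgroupN.
Qed.

Lemma derivation_iter_in n a : B a -> B (iter n d a).
Proof. by case: dB => Bd _ _ Ba; elim: n => //= n IHn; apply: Bd. Qed.

Lemma derivation_iterD n a b : B a -> B b ->
  iter n d (a + b) = iter n d a + iter n d b.
Proof.
move=> Ba Bb; elim: n => //= n ->.
by case: dB => _ -> //; apply: derivation_iter_in.
Qed.

Lemma derivation_iterB n a b : B a -> B b ->
  iter n d (a - b) = iter n d a - iter n d b.
Proof.
move=> Ba Bb; elim: n => //= n ->.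
by rewrite derivationB //; apply: derivation_iter_in.
Qed.

Lemma derivation_iter0 n : iter n d 0 = 0.
Proof. by elim: n => //= n ->; apply: derivation0. Qed.

Lemma derivation_iterM n a b : B a -> B b ->
  iter n.+1 d (a * b) = iter n d (d a * b) + iter n d (a * d b).
Proof.
move=> Ba Bb; case: (dB) => Bd _ dM; rewrite iterSr dM // derivation_iterD //.
  by case: sB => _ _; apply => //; apply: Bd.
by case: sB => _ _; apply => //; apply: Bd.
Qed.

Section LeibnizModulo.
Variable P : set S.
Hypothesis iP : ideal_in B P.

Definition order_ge k a := forall i, (i < k)%N -> P (iter i d a).

Lemma order_ge_derivation k a : order_ge k a -> order_ge k.-1 (d a).
Proof. by move=> oa i ik; rewrite -iterSr; apply: oa; lia. Qed.

Lemma iter_derivation_small k l a b n : B a -> B b ->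
  order_ge k a -> order_ge l b -> (n < k + l)%N -> P (iter n d (a * b)).
Proof.
have [sP _ PMl PMr] := iP; have [Bd _ _] := dB.
elim: n k l a b => [|n IHn] k l a b Ba Bb oa ob lt_n_kl.
  have [k0|k0] := posnP k; last by apply: PMr => //; apply: (oa 0%N).
  by apply: PMl => //; apply: (ob 0%N); lia.
rewrite derivation_iterM //; apply: subgroupD => //.
  by apply: (IHn k.-1 l); try lia; auto; apply: order_ge_derivation.
by apply: (IHn k l.-1); try lia; auto; apply: order_ge_derivation.
Qed.

(** Modulo [P] the Leibniz expansion of the (k+l)-th derivative of a product of
    elements of orders k and l has a single surviving term. *)
Lemma iter_derivation_lead k l a b : B a -> B b ->
  order_ge k a -> order_ge l b ->
  P (iter (k + l) d (a * b) - (iter k d a * iter l d b) *+ 'C(k + l, k)).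
Proof.
have [sP _ PMl PMr] := iP; have [Bd _ _] := dB.
have [n] := ubnP (k + l); elim: n k l a b => // n IHn k l a b lt_kl Ba Bb oa ob.
case: k l oa ob lt_kl => [|k] [|l] oa ob lt_kl.
- by rewrite /= subrr; apply: subgroup0.
- have := IHn 0%N l a (d b) _ Ba (Bd b Bb) oa (order_ge_derivation ob).
  rewrite !add0n !bin0 !mulr1n derivation_iterM // -iterSr => H.
  rewrite -addrA; apply: subgroupD => //; last by apply: H; lia.
  by apply: (@iter_derivation_small 0 l.+1); auto; rewrite /order_ge; lia.
- have := IHn k 0%N (d a) b _ (Bd a Ba) Bb (order_ge_derivation oa) ob.
  rewrite !addn0 !binn !mulr1n derivation_iterM // -iterSr => H.
  rewrite addrAC; apply: subgroupD => //; first by apply: H; lia.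
  by apply: (@iter_derivation_small k.+1 0); auto; rewrite /order_ge; lia.
have := IHn k l.+1 (d a) b _ (Bd a Ba) Bb (order_ge_derivation oa) ob.
have := IHn k.+1 l a (d b) _ Ba (Bd b Bb) oa (order_ge_derivation ob).
rewrite !addSn !addnS (derivation_iterM _ Ba Bb) -(iterSr k d a) -(iterSr l d b) => H1 H2.
rewrite binS mulrnDr.
by rewrite [iter _ d (d a * b) + _]addrC opprD addrACA; apply: subgroupD => //;
  [apply: H1 | apply: H2]; lia.
Qed.

End LeibnizModulo.

(** Characteristic 0 enters here: the binomial coefficient left over in the
    Leibniz expansion can be cancelled. *)
Lemma prime_core P : prime_in B P ->
    (forall m, exists2 u, B u & u * m.+1%:R = 1) ->
  prime_in B [set a | B a /\ forall k, P (iter k d a)].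
Proof.
move=> [iP P1 prP] Qalg; have [sgB B1 BM] := sB; have [sP PB PMl PMr] := iP.
have cancel m a : P (a *+ m.+1) -> P a.
  move=> Pma; have [u Bu um1] := Qalg m.
  by rewrite -[a]mul1r -um1 -mulrA mulr_natl; apply: PMl.
split=> [|[_ /(_ 0%N)] //|a b Ba Bb core_ab].
  split=> [||r a Br [Ba core_a]|r a Br [Ba core_a]].
  - split=> [|a b [Ba core_a] [Bb core_b]].
      split=> [|k]; first exact: subgroup0.
      by rewrite derivation_iter0; apply: subgroup0.
    split=> [|k]; first exact: subgroupB.
    by rewrite derivation_iterB //; apply: subgroupB.
  - by move=> a [].
  - split=> [|k]; first exact: BM.
    by apply: (iter_derivation_small iP (k := 0) (l := k.+1)) => // i _.
  - split=> [|k]; first exact: BM.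
    by apply: (iter_derivation_small iP (k := k.+1) (l := 0)) => //; lia.
(* Otherwise some derivatives of a and b lie outside P; take the first ones. *)
have first_out c : ~ (forall k, P (iter k d c)) ->
    exists2 k, order_ge P k c & ~ P (iter k d c).
  move/existsNP=> /= [k0 Pk0].
  have exk : exists k, `[< ~ P (iter k d c) >] by exists k0; apply/asboolP.
  case: (ex_minnP exk) => k /asboolP Pk min_k; exists k => // i ik.
  by apply: contrapT => Pi; have := min_k i (asboolT Pi); lia.
have [core_a|/first_out [k oa Pk]] := pselect (forall k, P (iter k d a)).
  by left.
have [core_b|/first_out [l ob Pl]] := pselect (forall k, P (iter k d b)).
  by right.
have [Bdk Bdl] := (derivation_iter_in k Ba, derivation_iter_in l Bb).
suff : P (iter k d a) \/ P (iter l d b) by case.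
apply: prP => // t Bt.
have Btb : B (t * b) by apply: BM.
have otb : order_ge P l (t * b).
  by move=> i il; apply: (iter_derivation_small iP (k := 0) (l := l)).
have [m m1] : exists m, 'C(k + l, k) = m.+1.
  by exists 'C(k + l, k).-1; rewrite prednK // bin_gt0; lia.
have Ptb : P (iter l d (t * b) - t * iter l d b).
  by have := iter_derivation_lead iP (k := 0) Bt Bb _ ob; rewrite bin0 mulr1n; apply.
have Patb := iter_derivation_lead iP Ba Btb oa otb.
have core_atb : P (iter (k + l) d (a * (t * b))).
  by rewrite mulrA; have [_] := core_ab t Bt; apply.
have PZ : P (iter k d a * iter l d (t * b)).
  apply: (@cancel m); rewrite -m1.
  by rewrite -[X in P X](subKr (iter (k + l) d (a * (t * b)))); apply: subgroupB.
have := subgroupB sP PZ (PMl _ _ Bdk Ptb).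
by rewrite -mulrBr subKr mulrA.
Qed.

End Derivation.

(** * Minimal primes over a stable ideal *)

Section Primes.
Variable B : set S.
Hypothesis sB : subring B.

(** An ideal maximal among those avoiding 1 is prime: for [b] outside it, the
    elements [y] with [y B b] inside it form an ideal that avoids 1. *)
Lemma exists_prime I : ideal_in B I -> ~ I 1 ->
  exists2 P, prime_in B P & I `<=` P.
Proof.
move=> iI I1; have [sgB B1 BM] := sB.
pose good X := ideal_in B (X `|` I) /\ ~ (X `|` I) 1.
have [F goodF chainF|M [[iM M1] maxM]] := @Zorn_bigcup S good.
  have [F0|/existsNP [X0 /contrapT FX0]] := pselect (forall X, ~ F X).
    have -> : \bigcup_(X in F) X = set0.
      by rewrite -subset0 => y [X /F0].
    by rewrite /good set0U.
  have goodX X := goodF X.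
  have cl y z : (\bigcup_(X in F) X `|` I) y -> (\bigcup_(X in F) X `|` I) z ->
      exists X, [/\ F X, (X `|` I) y & (X `|` I) z].
    move=> [[X FX Xy]|Iy] [[Z FZ Zz]|Iz].
    - have [XZ|ZX] := chainF X Z FX FZ.
        by exists Z; split=> //; left; auto.
      by exists X; split=> //; left; auto.
    - by exists X; split=> //; [left|right].
    - by exists Z; split=> //; [right|left].
    - by exists X0; split=> //; right.
  have sub X : F X -> (X `|` I) `<=` (\bigcup_(X in F) X `|` I).
    by move=> FX y [Xy|Iy]; [left; exists X|right].
  split; last first.
    by case=> [[X FX X1]|//]; have [_] := goodX X FX; apply; left.
  split=> [|y|r a Br|r a Br].
  - split=> [|a b ca cb]; first by right; case: iI => [[]].
    have [X [FX Xa Xb]] := cl a b ca cb; apply: (sub X FX).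
    by have [[sX _ _ _] _] := goodX X FX; apply: subgroupB.
  - case=> [[X FX Xy]|]; last by case: iI => _ IB _ _; apply: IB.
    by have [[_ XB _ _] _] := goodX X FX; apply: XB; left.
  - move=> ca; have [X [FX Xa _]] := cl a a ca ca; apply: (sub X FX).
    by have [[_ _ XM _] _] := goodX X FX; apply: XM.
  - move=> ca; have [X [FX Xa _]] := cl a a ca ca; apply: (sub X FX).
    by have [[_ _ _ XM] _] := goodX X FX; apply: XM.
set P := M `|` I in iM M1.
have maxP J : ideal_in B J -> P `<=` J -> ~ J 1 -> J `<=` P.
  move=> iJ PJ J1 y Jy; apply: contrapT => Py.
  apply: (maxM J).
    split=> [z Mz|JM]; first by apply: PJ; left.
    by apply: Py; left; apply: JM.
  by rewrite /good setUidl // => z Iz; apply: PJ; right.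
exists P; last by move=> y Iy; right.
split=> // a b Ba Bb aBb; have [sP PB PMl PMr] := iM.
pose J := [set y | B y /\ forall t, B t -> P (y * t * b)].
have [J1|J1] := pselect (J 1).
  by right; have [_ /(_ 1 B1)] := J1; rewrite !mul1r.
left; apply: (maxP J) => //; last first.
  by move=> y Py; split=> [|t Bt]; [apply: PB|by do 2!apply: (PMr) => //].
split=> [|y [] //|r y Br [By Jy]|r y Br [By Jy]].
- split=> [|y z [By Jy] [Bz Jz]].
    by split=> [|t Bt]; [case: sgB|rewrite !mul0r; case: sP].
  split=> [|t Bt]; first exact: subgroupB.
  by rewrite !mulrBl; apply: subgroupB => //; auto.
- split=> [|t Bt]; first exact: BM.
  by rewrite -!mulrA; apply: PMl => //; rewrite mulrA; apply: Jy.
- split=> [|t Bt]; first exact: BM.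
  by rewrite -(mulrA y); apply: Jy; apply: BM.
Qed.

(** Zorn's lemma downwards: with [M] a prime over [I], it is applied to the sets
    [X] whose complement in [M] is such a prime, ordered by inclusion. The
    intersection of a chain of primes is prime, since if [a] and [b] lie outside
    it, then both lie outside a common member. *)
Lemma exists_minimal_prime I : ideal_in B I -> ~ I 1 ->
  exists P, [/\ prime_in B P, I `<=` P &
    forall Q, prime_in B Q -> I `<=` Q -> Q `<=` P -> P `<=` Q].
Proof.
move=> iI I1; have [M prM IM] := exists_prime iI I1.
pose good X := prime_in B (M `\` X) /\ I `<=` M `\` X.
have [F goodF chainF|X [[prX IX] maxX]] := @Zorn_bigcup S good; last first.
  exists (M `\` X); split=> // Q prQ IQ QX; apply: contrapT => nXQ.
  have MMQ : M `\` (M `\` Q) = Q.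
    by rewrite setDD setIidr // => y /QX [].
  apply: (maxX (X `|` (M `\` Q))).
    split=> [y|sub]; first by left.
    apply: nXQ => y [My Xy]; apply: contrapT => Qy.
    by apply: Xy; apply: sub; right.
  suff -> : good (X `|` (M `\` Q)) = good (M `\` Q) by rewrite /good MMQ.
  rewrite /good setDUr MMQ setIidr //.
have goodX X : F X -> _ := goodF X; have [iM M1 prMM] := prM.
have [sM MB MMl MMr] := iM.
have memP y : (M `\` \bigcup_(X in F) X) y <->
    M y /\ forall X, F X -> (M `\` X) y.
  split=> [[My nFy]|[My nFy]]; split=> //.
    by move=> X FX; split=> // Xy; apply: nFy; exists X.
  by case=> X FX Xy; have [] := nFy X FX.
split; last first.
  by move=> y Iy; apply/memP; split=> [|X FX]; [apply: IM|case: (goodX X FX) => _; apply].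
split=> [||a b Ba Bb ab].
- split=> [|y /memP [/MB] //|r a Br /memP [Ma Fa]|r a Br /memP [Ma Fa]].
  + split=> [|a b /memP [Ma Fa] /memP [Mb Fb]]; apply/memP; split.
    * exact: subgroup0.
    * by move=> X /goodX [[[[X0 _]]]].
    * exact: subgroupB.
    * by move=> X FX; case: (goodX X FX) => [[[sX _ _ _]] _ _ _]; apply: subgroupB; auto.
  + apply/memP; split=> [|X FX]; first exact: MMl.
    by case: (goodX X FX) => [[[_ _ XM _]] _ _ _]; apply: XM; auto.
  + apply/memP; split=> [|X FX]; first exact: MMr.
    by case: (goodX X FX) => [[[_ _ _ XM]] _ _ _]; apply: XM; auto.
- by case.
have [Fa|nFa] := pselect ((M `\` \bigcup_(X in F) X) a); first by left.
have [Fb|nFb] := pselect ((M `\` \bigcup_(X in F) X) b); first by right.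
exfalso.
have ex_out c : ~ (M `\` \bigcup_(X in F) X) c ->
    ~ M c \/ exists2 X, F X & ~ (M `\` X) c.
  move=> nFc; have [Mc|] := pselect (M c); last by left.
  right; apply: contrapT => nX; apply: nFc; split=> // -[X FX Xc].
  by apply: nX; exists X => // -[].
have out X c : F X -> ~ M c -> ~ (M `\` X) c by move=> _ Mc [].
have prim X : F X -> (M `\` X) a \/ (M `\` X) b.
  move=> FX; have [[_ _ prX] _] := goodX X FX; apply: prX => // t Bt.
  by have /memP[_] := ab t Bt; apply.
have [Ma|[X FX Xa]] := ex_out a nFa.
  have [Mb|[Z FZ Zb]] := ex_out b nFb.
    have [] := prMM a b Ba Bb _ => //.
    by move=> t Bt; have /memP[] := ab t Bt.
  by have [[]|] := prim Z FZ.
have [Mb|[Z FZ Zb]] := ex_out b nFb; first by have [|[]] := prim X FX.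
have [XZ|ZX] := chainF X Z FX FZ.
  have [[Ma Za]|//] := prim Z FZ.
  by apply: Xa; split=> // /XZ.
have [//|[Mb Xb]] := prim X FX.
by apply: Zb; split=> // /ZX.
Qed.

(** The largest [d]-stable ideal in a minimal prime over [I] is a prime over [I],
    hence is the minimal prime itself. Using minimality rather than the core of
    an arbitrary prime treats all the derivations at once, although they need
    not commute. *)
Lemma exists_stable_prime I (D : set (S -> S)) :
    (forall m, exists2 u, B u & u * m.+1%:R = 1) ->
    (forall d, D d -> derivation_on B d /\ stable d I) ->
    ideal_in B I -> ~ I 1 ->
  exists P, [/\ prime_in B P, I `<=` P & forall d, D d -> stable d P].
Proof.
move=> Qalg Dd iI I1; have [P [prP IP minP]] := exists_minimal_prime iI I1.
exists P; split=> // d /Dd [dB dI] a Pa.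
have prC := prime_core sB dB prP Qalg.
have IC : I `<=` [set y | B y /\ forall k, P (iter k d y)].
  move=> y Iy; have [_ IB _ _] := iI; split=> [|k]; first exact: IB.
  by apply: IP; elim: k => //= k; apply: dI.
have CP : [set y | B y /\ forall k, P (iter k d y)] `<=` P.
  by move=> y [_ /(_ 0%N)].
by have [_ /(_ 1%N)] := minP _ prC IC CP a Pa.
Qed.

End Primes.
End Subsets.

(** * Powers of ideals of a subring *)

Section Powers.
Variable S : nzRingType.
Implicit Types (A B I J P X Y : set S) (d : S -> S).

Lemma ideal_mul_gen I J a b : I a -> J b -> ideal_mul I J (a * b).
Proof.
by move=> Ia Jb; exists 1%N, (fun=> a), (fun=> b); rewrite big_ord1.
Qed.

Lemma ideal_mul_min I J X : subgroup X ->
  (forall a b, I a -> J b -> X (a * b)) -> ideal_mul I J `<=` X.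
Proof.
move=> sX XIJ _ [m [a [b [ab ->]]]]; apply: subgroup_sum => // i.
by apply: XIJ; case: (ab i).
Qed.

Lemma subgroup_ideal_mul I J : subgroup I -> subgroup (ideal_mul I J).
Proof.
move=> sI; split=> [|_ _ [m [a [b [ab ->]]]] [n [a' [b' [ab' ->]]]]].
  by exists 0%N, (fun=> 0), (fun=> 0); split=> [[]|] //; rewrite big_ord0.
exists (m + n)%N,
  (fun i => match split i with inl j => a j | inr k => - a' k end),
  (fun i => match split i with inl j => b j | inr k => b' k end); split.
  move=> i; case: splitP => j _; first exact: ab.
  by have [Ia' Jb'] := ab' j; split=> //; apply: subgroupN.
rewrite big_split_ord /= -sumrN; congr (_ + _); apply: eq_bigr => i _.
  by case: splitP => j /= ij; [congr (a _ * b _); apply: val_inj|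
    have := ltn_ord i; lia].
case: splitP => j /= ij; first by have := ltn_ord j; lia.
by rewrite mulNr; congr (- (a' _ * b' _)); apply: val_inj => /=; lia.
Qed.

Lemma ideal_in_mul B I J : ideal_in B I -> ideal_in B J ->
  ideal_in B (ideal_mul I J).
Proof.
move=> [sI IB IMl IMr] [sJ JB JMl JMr]; have sIJ := subgroup_ideal_mul J sI.
split=> // [u|r u Br|r u Br].
- suff IJI : ideal_mul I J `<=` I by move=> /IJI; apply: IB.
  by apply: ideal_mul_min => // a b Ia Jb; apply: IMr => //; apply: JB.
- apply: (ideal_mul_min (subgroup_mull r sIJ)) => a b Ia Jb /=.
  by rewrite mulrA; apply: ideal_mul_gen => //; apply: IMl.
- apply: (ideal_mul_min (subgroup_mulr r sIJ)) => a b Ia Jb /=.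
  by rewrite -mulrA; apply: ideal_mul_gen => //; apply: JMr.
Qed.

Lemma stable_ideal_mul B d I J : subring B -> derivation_on B d ->
  ideal_in B I -> ideal_in B J -> stable d I -> stable d J ->
  stable d (ideal_mul I J).
Proof.
move=> sB dB iI iJ dI dJ u IJu.
have [sIJ IJB _ _] := ideal_in_mul iI iJ.
have sub : subgroup [set u | B u /\ ideal_mul I J (d u)].
  have [sgB _ _] := sB.
  split=> [|a b [Ba da] [Bb db]] /=.
    by rewrite (derivation0 sB dB); split; [case: sgB|case: sIJ].
  by rewrite (derivationB sB dB) //; split; apply: subgroupB.
suff /(_ u IJu) [] : ideal_mul I J `<=` [set u | B u /\ ideal_mul I J (d u)] by [].
apply: (ideal_mul_min sub) => a b Ia Jb; have [[_ IB _ _] [_ JB _ _]] := (iI, iJ).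
split; first exact/IJB/ideal_mul_gen.
case: dB => _ _ ->; auto.
by apply: subgroupD => //; apply: ideal_mul_gen; auto.
Qed.

Lemma ideal_mulS I I' J J' : I `<=` I' -> J `<=` J' ->
  ideal_mul I J `<=` ideal_mul I' J'.
Proof.
move=> II' JJ' _ [m [a [b [ab ->]]]]; exists m, a, b; split=> // i.
by have [Ia Jb] := ab i; split; auto.
Qed.

(** The constructions of [ideal_exp], [ideal_cap] and [ideal_itercap] inside a
    subring [B]; an empty product of ideals of [B] is [B]. *)
Definition exp_in B I k := iter k (ideal_mul I) B.
Definition cap_in B I := \bigcap_k exp_in B I k.
Definition itercap_in B I m := iter m (cap_in B) I.

Lemma ideal_exp_in B I k : subring B -> ideal_in B I -> ideal_in B (exp_in B I k).
Proof.
move=> [sB B1 BM] iI; elim: k => [|k IHk]; last exact: ideal_in_mul.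
by split=> // r a Br Ba; apply: BM.
Qed.

Lemma ideal_cap_in B I : subring B -> ideal_in B I -> ideal_in B (cap_in B I).
Proof.
move=> sB iI; have iE k := ideal_exp_in k sB iI.
split=> [|a|r a Br Ia k _|r a Br Ia k _].
- split=> [k _|a b Ia Ib k _]; have [sE _ _ _] := iE k; first by case: sE.
  by apply: subgroupB => //; [apply: Ia|apply: Ib].
- by move=> Ia; apply: (Ia 0%N).
- by have [_ _ + _] := iE k; apply=> //; apply: Ia.
- by have [_ _ _] := iE k; apply=> //; apply: Ia.
Qed.

Lemma ideal_itercap_in B I m : subring B -> ideal_in B I ->
  ideal_in B (itercap_in B I m).
Proof. by move=> sB iI; elim: m => //= m; apply: ideal_cap_in. Qed.

Lemma stable_exp_in B d I k : subring B -> derivation_on B d ->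
  ideal_in B I -> stable d I -> stable d (exp_in B I k).
Proof.
move=> sB dB iI dI; elim: k => [|k IHk]; first by case: dB.
by apply: (stable_ideal_mul sB dB) => //; apply: ideal_exp_in.
Qed.

Lemma stable_itercap_in B d I m : subring B -> derivation_on B d ->
  ideal_in B I -> stable d I -> stable d (itercap_in B I m).
Proof.
move=> sB dB iI dI; elim: m => //= m IHm a Ia k _.
by apply: (stable_exp_in sB dB) => //; [apply: ideal_itercap_in|apply: Ia].
Qed.

Lemma exp_inS B I J k : I `<=` J -> exp_in B I k `<=` exp_in B J k.
Proof. by move=> IJ; elim: k => //= k; apply: ideal_mulS. Qed.

Lemma itercap_inS B I J m : I `<=` J -> itercap_in B I m `<=` itercap_in B J m.
Proof.
move=> IJ; elim: m => //= m IHm a Ia k _.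
by apply: (exp_inS IHm); apply: Ia.
Qed.

End Powers.

(** * Differential polynomials with coefficients in a given set *)

Section DiffPoly.
Variables (S : nzRingType) (A B : set S) (d : S -> S) (x : S).
Hypotheses (sA : subring A) (sB : subring B) (AxB : diff_poly_ring A d x B).
Implicit Types (c p : set S) (u v : S).

(** The set [c[x]] of the polynomials in [x] with coefficients in [c], and below
    its part [polys c n] of degree less than [n]. *)
Definition polyx c := [set f.[x] | f in [set f : {poly S} | forall k, c f`_k]].

Definition polys c n := [set f.[x] |
  f in [set f : {poly S} | (size f <= n)%N /\ forall k, c f`_k]].

(** [a] may vanish: this says that [u] has degree at most [n], with coefficient
    [a] in degree [n]. *)
Definition lead n a u := A a /\ polys A n (u - a * x ^+ n).

Lemma polyxP c u : polyx c u <-> exists n, polys c n u.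
Proof.
split=> [[f cf <-]|[n [f [_ cf] <-]]]; last by exists f.
by exists (size f), f.
Qed.

Lemma polys_polyx c n u : polys c n u -> polyx c u.
Proof. by move=> cu; apply/polyxP; exists n. Qed.

Lemma polys_min c n X : subgroup X ->
  (forall a i, (i < n)%N -> c a -> X (a * x ^+ i)) -> polys c n `<=` X.
Proof.
move=> sX Xmon _ [f [fn cf] <-]; rewrite (horner_coef_wide _ fn).
by apply: subgroup_sum => // i; apply: Xmon.
Qed.

Lemma polys_sub c c' n n' : c `<=` c' -> (n <= n')%N -> polys c n `<=` polys c' n'.
Proof.
move=> cc' nn' _ [f [fn cf] <-]; exists f => //; split=> [|k]; last exact: cc'.
exact: leq_trans nn'.
Qed.

Lemma polyx_sub c c' : c `<=` c' -> polyx c `<=` polyx c'.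
Proof. by move=> cc' _ [f cf <-]; exists f => // k; apply: cc'. Qed.

Lemma subgroup_polys c n : subgroup c -> subgroup (polys c n).
Proof.
move=> sc; split=> [|_ _ [f [fn cf] <-] [g [gn cg] <-]].
  exists 0; last by rewrite horner0.
  by split=> [|k]; rewrite ?size_poly0 // coef0; case: sc.
exists (f - g); last by rewrite hornerD hornerN.
split=> [|k]; last by rewrite coefB; apply: subgroupB.
by rewrite (leq_trans (size_polyD _ _)) // geq_max fn size_polyN.
Qed.

Lemma subgroup_polyx c : subgroup c -> subgroup (polyx c).
Proof.
move=> sc; split=> [|_ _ [f cf <-] [g cg <-]].
  by exists 0; rewrite ?horner0 // => k /=; rewrite coef0; case: sc.
exists (f - g); last by rewrite hornerD hornerN.
by move=> k /=; rewrite coefB; apply: subgroupB.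
Qed.

Lemma polys_monomial c n a i : subgroup c -> (i < n)%N -> c a ->
  polys c n (a * x ^+ i).
Proof.
move=> sc i_n ca; exists (a *: 'X^i); last by rewrite hornerZ hornerXn.
split=> [|k]; first by rewrite (leq_trans (size_scale_leq _ _)) // size_polyXn.
by rewrite coefZ coefXn; case: eqP; rewrite ?mulr1 ?mulr0 //; case: sc.
Qed.

Lemma polys0E c u : polys c 0 u -> u = 0.
Proof. by move=> [f [f0 _] <-]; rewrite (size_poly_leq0P _ f0) horner0. Qed.

Lemma polysS_lead n u : polys A n.+1 u -> exists a, lead n a u.
Proof.
move=> [f [fn Af] <-]; exists f`_n; split; first exact: Af.
rewrite (horner_coef_wide _ fn) big_ord_recr /= addrK.
have [sgA _ _] := sA; have sp := subgroup_polys n sgA.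
by apply: subgroup_sum => // i; apply: polys_monomial.
Qed.

(** Uses that the powers of [x] are independent over [A]. *)
Lemma polyx_lead p n a u : p `<=` A -> polyx p u -> lead n a u -> p a.
Proof.
move=> pA [g pg <-] [Aa [f [fn Af] fE]]; have [_ _ _ free] := AxB.
suff -> : a = g`_n by [].
have -> : g = f + a *: 'X^n.
  apply: free => [k|k|]; first exact/pA/pg; last first.
    by rewrite hornerD hornerZ hornerXn fE subrK.
  have [sgA A1 AM] := sA; rewrite coefD coefZ coefXn; apply: subgroupD => //.
  by apply: AM => //; case: eqP => _ //; case: sgA.
by rewrite coefD coefZ coefXn eqxx mulr1 nth_default // add0r.
Qed.

Lemma polyx_bigcap (c : nat -> set S) u : (forall k, c k `<=` A) ->
  (forall k, polyx (c k) u) -> polyx (\bigcap_k c k) u.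
Proof.
move=> cA cu; have [f cf fu] := cu 0%N; have [_ _ _ free] := AxB.
exists f => // i k _; have [g cg gu] := cu k.
suff -> : f = g by [].
by apply: free => [j|j|]; [apply: (cA 0%N)|apply: (cA k)|rewrite fu gu].
Qed.

Let sgA : subgroup A. Proof. by case: sA. Qed.
Let AA : A `<=` A. Proof. by []. Qed.
Let AM a b : A a -> A b -> A (a * b). Proof. by case: sA => _ _; apply. Qed.
Let dA : derivation_on A d. Proof. by case: AxB. Qed.
Let dAA : stable d A. Proof. by case: dA. Qed.
Let xA a : A a -> x * a = a * x + d a.
Proof. by case: AxB => _ xa _ _ Aa; rewrite -(xa a Aa) addrC subrK. Qed.
Let BE : B = polyx A. Proof. by case: AxB. Qed.

Section StableCoefficients.
Variable c : set S.
Hypotheses (sc : subgroup c) (cA : c `<=` A) (dc : stable d c).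

(** Stability under [d] is what makes [c[x]] closed under multiplication by [x]
    on the left, the coefficients being written on the left. *)
Lemma polys_mulx n u : polys c n u -> polys c n.+1 (x * u).
Proof.
have sp := subgroup_polys n.+1 sc.
apply: (polys_min (subgroup_mull x sp)) => a i i_n ca /=.
rewrite mulrA xA; last exact: cA.
rewrite mulrDl -mulrA -exprS; apply: subgroupD => //.
  exact: polys_monomial.
by apply: polys_monomial; auto; lia.
Qed.

Lemma polys_commutator n u : polys c n u -> polys c n (x * u - u * x).
Proof.
have sp := subgroup_polys n sc.
have sp' : subgroup [set u | polys c n (x * u - u * x)].
  split=> [|a b]; rewrite /= ?mulr0 ?mul0r ?subrr; first by case: sp.
  by move=> ca cb; rewrite mulrBr mulrBl subrACA; apply: subgroupB.
apply: (polys_min sp') => a i i_n ca /=.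
rewrite mulrA xA; last exact: cA.
rewrite mulrDl -!mulrA -exprS -exprSr addrAC subrr add0r.
by apply: polys_monomial; auto.
Qed.

Lemma polys_mulxn n i u : polys c n u -> polys c (n + i) (x ^+ i * u).
Proof.
move=> cu; elim: i => [|i IHi]; first by rewrite mul1r addn0.
by rewrite exprS -mulrA addnS; apply: polys_mulx.
Qed.

Lemma polys_commutator_xn i a : c a -> polys c i (x ^+ i * a - a * x ^+ i).
Proof.
move=> ca; have sp := subgroup_polys i sc.
elim: i {sp} => [|i IHi].
  by rewrite mul1r mulr1 subrr; case: (subgroup_polys 0 sc).
have sp := subgroup_polys i.+1 sc.
have -> : x ^+ i.+1 * a - a * x ^+ i.+1 =
    x * (x ^+ i * a - a * x ^+ i) + d a * x ^+ i.
  rewrite mulrBr !mulrA -exprS xA; last exact: cA.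
  by rewrite mulrDl opprD addrA subrK -mulrA -exprS.
apply: subgroupD => //; first exact: polys_mulx.
by apply: polys_monomial; auto.
Qed.

Lemma polys_mul c1 c2 m n u v : subgroup c2 ->
    (forall a b, c1 a -> c b -> c2 (a * b)) ->
  polys c1 m u -> polys c n v -> polys c2 (m + n).-1 (u * v).
Proof.
move=> sc2 c12 + cv; have sp := subgroup_polys (m + n).-1 sc2.
apply: (polys_min (subgroup_mulr v sp)) => a i i_m c1a /=.
have := polys_mulxn i cv; rewrite -mulrA.
apply: (polys_min (subgroup_mull a sp)) => b j j_m cb /=.
by rewrite mulrA; apply: polys_monomial; [|lia|apply: c12].
Qed.

End StableCoefficients.

Lemma leadB n a b u v : lead n a u -> lead n b v -> lead n (a - b) (u - v).
Proof.
move=> [Aa Pu] [Ab Pv]; split; first exact: subgroupB.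
have := subgroupB (subgroup_polys n sgA) Pu Pv.
by rewrite mulrBl subrACA.
Qed.

Lemma lead0 n u : lead n 0 u <-> polys A n u.
Proof.
rewrite /lead mul0r subr0; split=> [[]//|Au]; split=> //.
by case: sgA.
Qed.

Lemma lead_polys n a u : lead n a u -> polys A n.+1 u.
Proof.
move=> [Aa Pu]; apply: subgroup_congr (polys_sub _ (leqnSn n) Pu) _ => //.
  exact: subgroup_polys.
exact: polys_monomial.
Qed.

Lemma lead_monomial n a : A a -> lead n a (a * x ^+ n).
Proof. by move=> Aa; split=> //; rewrite subrr; case: (subgroup_polys n sgA). Qed.

Lemma lead_const a : A a -> lead 0 a a.
Proof. by move=> Aa; have := lead_monomial 0 Aa; rewrite mulr1. Qed.

Lemma lead_mul m n a b u v :
  lead m a u -> lead n b v -> lead (m + n) (a * b) (u * v).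
Proof.
move=> ua vb; have [[Aa Pu] [Ab Pv]] := (ua, vb); split; first exact: AM.
have mulP k l : (k + l).-1 = (m + n)%N -> forall y z, polys A k y -> polys A l z ->
    polys A (m + n) (y * z).
  by move=> <- y z; apply: (polys_mul sgA AA dAA).
have sp := subgroup_polys (m + n) sgA.
have -> : u * v - a * b * x ^+ (m + n) = (u - a * x ^+ m) * v
    + (a * x ^+ m * (v - b * x ^+ n)
      + a * ((x ^+ m * b - b * x ^+ m) * x ^+ n)).
  rewrite exprD !mulrBl !mulrBr !mulrA [a * _ * v - _ + _]addrA subrK.
  by rewrite addrA subrK.
have A1 : A 1 by case: sA.
apply: subgroupD => //; first by apply: (mulP _ n.+1 _ _ _ Pu (lead_polys vb)); lia.
apply: subgroupD => //.
  by apply: (mulP m.+1 _ _ _ _ _ Pv); [|exact: polys_monomial].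
rewrite mulrA; apply: (mulP m n.+1); first lia.
  rewrite -[a]mulr1 -(expr0 x).
  have Pa : polys A 1 (a * x ^+ 0) by apply: polys_monomial.
  by have := polys_mul sgA AA dAA sgA AM Pa (polys_commutator_xn sgA AA dAA m Ab); apply.
by rewrite -[x ^+ n]mul1r; apply: polys_monomial.
Qed.

Lemma polyx_sub_ideal I c : ideal_in B I -> c `<=` I -> polyx c `<=` I.
Proof.
move=> [sI IB _ IMr] cI u /polyxP [n]; apply: (polys_min sI) => a i _ ca.
apply: IMr; last exact: cI.
rewrite BE; apply: (@polys_polyx _ i.+1); rewrite -[x ^+ i]mul1r.
by apply: polys_monomial => //; case: sA.
Qed.

Lemma ideal_polyx p : ideal_in A p -> stable d p -> ideal_in B (polyx p).
Proof.
move=> [sp pA pMl pMr] dp; rewrite BE; split.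
- exact: subgroup_polyx.
- exact: polyx_sub.
- move=> r a /polyxP [m rm] /polyxP [n an].
  by apply: polys_polyx; apply: (polys_mul sp pA dp sp) rm an.
- move=> r a /polyxP [m rm] /polyxP [n an].
  apply: polys_polyx; apply: (polys_mul sgA AA dAA sp) an rm => //.
  by move=> ? ? ? ?; apply: pMr.
Qed.

(** Leading terms with coefficient in [p] are dropped until one is met whose
    coefficient is outside [p]. *)
Lemma polyx_reduce p n u : subgroup p -> polys A n u -> ~ polyx p u ->
  exists m w u0, [/\ (m < n)%N, ~ p w, lead m w u0 & polyx p (u - u0)].
Proof.
move=> sp; have spx := subgroup_polyx sp; elim: n u => [|n IHn] u Au pu.
  by case: pu; rewrite (polys0E Au); case: spx.
have [a ua] := polysS_lead Au; have [pa|pa] := pselect (p a); last first.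
  by exists n, a, u; split=> //; rewrite subrr; case: spx.
have pax : polyx p (a * x ^+ n).
  by apply: (@polys_polyx _ n.+1); apply: polys_monomial.
have [|m [w [u0 [mn pw u0w pu0]]]] := IHn _ ua.2.
  by move=> pu0; apply: pu; apply: subgroup_congr pu0 pax.
exists m, w, u0; split=> //; first exact: ltnW.
by apply: subgroup_congr spx _ pax => //; rewrite addrAC.
Qed.

(** Moving the powers of [x] in a product of elements of [p[x]] to the right
    differentiates the coefficients, which remain in the same power of [p]. *)
Lemma exp_polyx p k : ideal_in A p -> stable d p ->
  exp_in B (polyx p) k `<=` polyx (exp_in A p k).
Proof.
move=> ip dp; have [sp pA pMl pMr] := ip.
elim: k => [|k IHk]; first by rewrite /= BE.
have [sE EA _ _] := ideal_exp_in k sA ip.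
have sE1 := ideal_exp_in k.+1 sA ip.
apply: ideal_mul_min; first by apply: subgroup_polyx; case: sE1.
move=> u v /polyxP [m um] /IHk /polyxP [n vn].
apply: polys_polyx; apply: (polys_mul sE EA _ _ _ um vn); first exact: stable_exp_in.
  by case: sE1.
by move=> a b pa Eb; apply: ideal_mul_gen.
Qed.

Lemma itercap_polyx p m : ideal_in A p -> stable d p ->
  itercap_in B (polyx p) m `<=` polyx (itercap_in A p m).
Proof.
move=> ip dp; elim: m => //= m IHm u Hu.
have iI := ideal_itercap_in m sA ip.
have dI := stable_itercap_in (m := m) sA dA ip dp.
apply: polyx_bigcap => [k|k]; first by case: (ideal_exp_in k sA iI).
by apply: exp_polyx => //; apply: (exp_inS IHm); apply: Hu.
Qed.

Section PrimeOver.
Variable P : set S.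
Hypothesis prP : prime_in B P.

Let p := P `&` A.

Let iP : ideal_in B P. Proof. by case: prP. Qed.
Let AB : A `<=` B.
Proof.
move=> a Aa; rewrite BE; apply: (@polys_polyx _ 1).
by rewrite -[a]mulr1 -(expr0 x); apply: polys_monomial.
Qed.
Let Bx : B x.
Proof.
rewrite BE; apply: (@polys_polyx _ 2).
by rewrite -[x]mul1r -[X in 1 * X]expr1; apply: polys_monomial => //; case: sA.
Qed.
Let BM a b : B a -> B b -> B (a * b). Proof. by case: sB => _ _; apply. Qed.
Let Bxn n : B (x ^+ n).
Proof. by elim: n => [|n IHn]; [case: sB|rewrite exprS; apply: BM]. Qed.

Lemma ideal_contraction : ideal_in A p.
Proof.
have [sP PB PMl PMr] := iP; split=> [|a []//|r a Ar [Pa Aa]|r a Ar [Pa Aa]].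
- split=> [|a b [Pa Aa] [Pb Ab]]; first by split; [case: sP|case: sgA].
  by split; apply: subgroupB.
- by split; [apply: PMl; auto|apply: AM].
- by split; [apply: PMr; auto|apply: AM].
Qed.

(** On [A], [d] is the commutator with [x]. *)
Lemma stable_contraction : stable d p.
Proof.
have [sP PB PMl PMr] := iP; move=> a [Pa Aa]; split; last exact: dAA.
have [_ <- // _ _] := AxB.
by apply: subgroupB => //; [apply: PMl|apply: PMr].
Qed.

Let sp : subgroup p. Proof. by case: ideal_contraction. Qed.
Let pA : p `<=` A. Proof. by move=> ? []. Qed.
Let ipx : ideal_in B (polyx p).
Proof. exact: ideal_polyx ideal_contraction stable_contraction. Qed.
Let spx : subgroup (polyx p). Proof. by case: ipx. Qed.
Let pxP : polyx p `<=` P.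
Proof. by apply: polyx_sub_ideal => // a []. Qed.

(** If [c w] lies in [p], then so does [c d(w)], because [d(b w) - d(b) w] is
    [b d(w)] and [c] is [d]-stable. Hence [c[x] w], which contains [b B w] for
    [b] in [c], lies in [p[x]], and [P] is prime. *)
Lemma prime_annihilator c w : c `<=` A -> stable d c -> subgroup c ->
    (forall r b, A r -> c b -> c (b * r)) -> ~ c `<=` p ->
  A w -> (forall b, c b -> p (b * w)) -> p w.
Proof.
move=> cA dc sc cMr /existsNP[b /not_implyP[cb pb]] Aw cw.
have [_ _ primeP] := prP; have [_ _ _ PMr] := iP.
pose ann := [set v | A v /\ forall b', c b' -> p (b' * v)].
have sann : subgroup ann.
  split=> [|v v' [Av cv] [Av' cv']].
    by split=> [|b' _]; [case: sgA|rewrite mulr0; case: sp].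
  split=> [|b' cb']; first exact: subgroupB.
  by rewrite mulrBr; apply: subgroupB; auto.
have dann : stable d ann.
  move=> v [Av cv]; split=> [|b' cb']; first exact: dAA.
  have [_ _ dM] := dA; have := stable_contraction (cv _ cb').
  rewrite dM //; last exact: cA.
  by move=> /(subgroupB sp)/(_ (cv _ (dc _ cb'))); rewrite addrC addKr.
have [|Pb|Pw] := primeP b w (AB (cA _ cb)) (AB Aw); last by split.
  move=> t; rewrite BE => /polyxP [n At].
  have cb0 : polys c 1 b.
    by rewrite -[b]mulr1 -(expr0 x); apply: polys_monomial.
  have w0 : polys ann 1 w.
    by rewrite -[w]mulr1 -(expr0 x); apply: polys_monomial.
  have cbt : polys c (1 + n).-1 (b * t).
    by apply: (polys_mul sgA AA dAA sc) cb0 At => // ? ? ? ?; apply: cMr.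
  apply: pxP; apply: polys_polyx.
  by apply: (polys_mul sann _ dann sp) cbt w0 => [v []|b' v cb' [_]] //; apply.
by case: pb; split=> //; apply: cA.
Qed.

Section MinimalDegree.
Variable m : nat.
Hypothesis m_gt0 : (0 < m)%N.
Hypothesis m_min : forall u, P u -> polys A m u -> polyx p u.

Definition leads := [set b | exists2 q, P q & lead m b q].

Hypothesis leads_p : ~ leads `<=` p.

(** The difference has degree less than [m]. *)
Lemma lead_unique b q q' : P q -> P q' -> lead m b q -> lead m b q' ->
  polyx p (q - q').
Proof.
have [sP _ _ _] := iP; move=> Pq Pq' lq lq'; apply: m_min.
  exact: subgroupB.
by apply/lead0; rewrite -(subrr b); apply: leadB.
Qed.

Let leadsA : leads `<=` A. Proof. by move=> b [q _ []]. Qed.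

Lemma leadsMr r b : A r -> leads b -> leads (b * r).
Proof.
move=> Ar [q Pq lq]; exists (q * r).
  by have [_ _ _] := iP; apply=> //; apply: AB.
by have := lead_mul lq (lead_const Ar); rewrite addn0.
Qed.

Lemma subgroup_leads : subgroup leads.
Proof.
have [sP _ _ _] := iP; split.
  by exists 0; [case: sP|apply/lead0; case: (subgroup_polys m sgA)].
move=> a b [q Pq lq] [q' Pq' lq']; exists (q - q'); first exact: subgroupB.
exact: leadB.
Qed.

(** The commutator with [x] differentiates the leading coefficient. *)
Lemma stable_leads : stable d leads.
Proof.
have [sP _ PMl PMr] := iP; move=> b [q Pq [Ab qb]]; exists (x * q - q * x).
  by apply: subgroupB => //; [apply: PMl|apply: PMr].
split; first exact: dAA.
have -> : x * q - q * x - d b * x ^+ m =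
    x * (q - b * x ^+ m) - (q - b * x ^+ m) * x.
  rewrite mulrBr mulrBl [RHS]subrACA; congr (_ - _).
  by rewrite mulrA xA // mulrDl -!mulrA -exprS -exprSr addrAC subrr add0r.
exact: (polys_commutator sgA AA dAA qb).
Qed.

Lemma leads_annihilator w : A w -> (forall b, leads b -> p (b * w)) -> p w.
Proof.
apply: prime_annihilator => //; [exact: stable_leads|exact: subgroup_leads|].
exact: leadsMr.
Qed.

Inductive leads_prod : nat -> S -> Prop :=
| leads_prod0 : leads_prod 0 1
| leads_prodS N e b : leads_prod N e -> leads b -> leads_prod N.+1 (e * b).

Lemma leads_prodA N e : leads_prod N e -> A e.
Proof.
by elim=> [|{}N {}e b _ Ae lb]; [case: sA|apply: AM => //; apply: leadsA].
Qed.

Lemma leads_prod_annihilator N w : A w -> ~ p w ->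
  exists2 e, leads_prod N e & ~ p (e * w).
Proof.
elim: N w => [|N IHN] w Aw pw; first by exists 1; [constructor|rewrite mul1r].
have [b lb pbw] : exists2 b, leads b & ~ p (b * w).
  apply: contrapT => nb; apply: pw; apply: leads_annihilator => // b lb.
  by apply: contrapT => pbw; apply: nb; exists b.
have [e le peb] := IHN (b * w) (AM (leadsA lb) Aw) pbw.
by exists (e * b); [constructor|rewrite -mulrA].
Qed.

(** Division of [u] by elements of [P] of the least degree [m], at the cost of a
    left factor [e]. Multiplying [u = a x ^ (m + N) + ...] by [b] and subtracting
    [q0 a x ^ N], with [q0 = b x ^ m + ...] in [P], lowers the degree. Multiplying
    by one more coefficient [c] gathers the subtracted terms into a multiple of a
    single [q]; it matters below that [s] does not depend on [c] and [q]. *)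
Lemma pseudo_division N e u : leads_prod N e -> P u -> polys A (m + N) u ->
  exists2 s, B s &
    forall c q : S, P q -> lead m c q -> polyx p (c * e * u - q * s).
Proof.
have [sP PB PMl PMr] := iP; have [_ pxB pxMl pxMr] := ipx.
move=> le; elim: le u => [|{}N {}e b le IHe lb] u Pu Au.
  exists 0; first by case: sB => -[].
  move=> c q Pq [Ac _]; rewrite mulr0 subr0 mulr1; apply: pxMl; first exact: AB.
  by apply: m_min; rewrite // -[m]addn0.
rewrite addnS in Au; have [a ua] := polysS_lead Au.
have Aa : A a by case: ua.
have [q0 Pq0 lq0] := lb; have Ab := leadsA lb; have Ae := leads_prodA le.
have Baxn : B (a * x ^+ N) by apply: BM; auto.
have [||s Bs sP'] := IHe (b * u - q0 * (a * x ^+ N)).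
- by apply: subgroupB => //; [apply: PMl; auto|apply: PMr].
- apply/lead0; rewrite -(subrr (b * a)); apply: leadB.
    exact: lead_mul (lead_const Ab) ua.
  exact: lead_mul lq0 (lead_monomial N Aa).
exists (s + e * b * (a * x ^+ N)).
  by have [sgB _ _] := sB; apply: subgroupD => //; apply: BM => //; apply: AB; apply: AM.
move=> c q Pq lq; have Ac : A c by case: lq.
(* Both [c e q0] and [q e b] lie in [P] with leading coefficient [c e b]. *)
have swap : polyx p (c * e * q0 - q * (e * b)).
  apply: (@lead_unique (c * e * b)).
  - by apply: PMl => //; apply: AB; apply: AM.
  - by apply: PMr => //; apply: AB; apply: AM.
  - exact: lead_mul (lead_const (AM Ac Ae)) lq0.
  - by have := lead_mul lq (lead_const (AM Ae Ab)); rewrite addn0 mulrA.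
have := subgroupD spx (sP' c q Pq lq) (pxMr _ _ Baxn swap).
congr (polyx p _); rewrite !mulrBr !mulrBl mulrDr !mulrA.
by rewrite [X in X + _ = _]addrAC addrA subrK opprD addrA.
Qed.

(** Modulo [p[x]], the elements of [P ^ k] have degree at least [k] or vanish. For
    [h] in [P ^ k.+1], pseudo-division of the first factors of its terms gives
    [c e h = q W] with [W] in [P ^ k]; if [W] does not vanish, then it has degree
    at least [k], so that the degree of [q W] is at least [m + k > k]. *)
Lemma exp_degree k h h0 : exp_in B P k h -> polyx p (h - h0) ->
  polys A k h0 -> polyx p h0.
Proof.
have [sP PB PMl PMr] := iP; have [_ pxB pxMl pxMr] := ipx.
elim: k h h0 => [|k IHk] h h0; first by move=> _ _ /polys0E ->; case: spx.
move=> [r [u [v [uv hE]]]] hh0 Ah0; apply: contrapT => ph0.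
have [t [w [h1 [tk pw h1w h01]]]] := polyx_reduce sp Ah0 ph0.
have Aw : A w by case: h1w.
have [N uN] : exists N, forall i, polys A (m + N) (u i).
  have /choice [f fP] i : exists n, polys A n (u i).
    by apply/polyxP; rewrite -BE; apply: PB; case: (uv i).
  exists (\max_i f i) => i; apply: polys_sub (fP i) => //.
  by rewrite (leq_trans (leq_bigmax i)) ?leq_addl.
have [e le pew] := leads_prod_annihilator N Aw pw; have Ae := leads_prodA le.
have /choice [s sE] i : exists s, B s /\
    forall c q : S, P q -> lead m c q -> polyx p (c * e * u i - q * s).
  by have [s Bs sE] := pseudo_division le (uv i).1 (uN i); exists s.
pose W := \sum_i s i * v i.
have EW : exp_in B P k W.
  have [sE' _ EMl _] := ideal_exp_in k sB iP.
  by apply: subgroup_sum => // i; apply: EMl; [case: (sE i)|case: (uv i)].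
have BW : B W by have [_ EB _ _] := ideal_exp_in k sB iP; apply: EB.
have cehW (c q : S) : P q -> lead m c q -> polyx p (c * e * h1 - q * W).
  move=> Pq lq; have Ac : A c by case: lq.
  have ceh : polyx p (c * e * (h1 - h)).
    apply: pxMl; first by apply: AB; apply: AM.
    have := subgroupN spx (subgroupD spx hh0 h01).
    by rewrite addrA subrK opprB.
  have : polyx p (c * e * h - q * W).
    rewrite hE !mulr_sumr -sumrB; apply: subgroup_sum => // i.
    rewrite !mulrA -mulrBl; apply: pxMr; last by case: (sE i) => _; apply.
    by have [_ EB _ _] := ideal_exp_in k sB iP; apply: EB; case: (uv i).
  by move=> /(subgroupD spx ceh); rewrite mulrBr addrA subrK.
have [pW|pW] := pselect (polyx p W).
  (* All [c e h1] lie in [p[x]], hence all [c e w] in [p]. *)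
  apply: pew; apply: leads_annihilator; first exact: AM.
  move=> c [q Pq lq]; have Ac : A c by case: lq.
  have ch : polyx p (c * e * h1).
    apply: subgroup_congr spx (cehW c q Pq lq) _.
    by apply: pxMl => //; apply: PB.
  have := lead_mul (lead_const (AM Ac Ae)) h1w => /(polyx_lead pA ch).
  by rewrite mulrA.
have [n /= AnW] : exists n, polys A n W by apply/polyxP; rewrite -BE.
have [j [b [W0 [_ pb W0b WW0]]]] := polyx_reduce sp AnW pW.
have Ab : A b by case: W0b.
have kj : (k <= j)%N.
  rewrite leqNgt; apply/negP => jk; apply: pW.
  apply: (subgroup_congr spx WW0); apply: (IHk _ _ EW WW0).
  exact: polys_sub (lead_polys W0b).
(* Now [q W] has degree m + j > k, whereas [c e h1] has degree at most k. *)
apply: pb; apply: leads_annihilator => // c [q Pq lq]; have Ac : A c by case: lq.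
have qW0 : polyx p (q * W0 - c * e * h1).
  have := subgroupN spx (subgroupD spx (cehW c q Pq lq) (pxMl _ _ (PB _ Pq) WW0)).
  by rewrite mulrBr addrA subrK opprB.
apply: (polyx_lead pA qW0 (n := m + j)).
rewrite -[c * b]subr0; apply: leadB; first exact: lead_mul.
have := lead_polys (lead_mul (lead_const (AM Ac Ae)) h1w).
by move=> ceh1; apply/lead0; apply: (polys_sub AA _ ceh1); lia.
Qed.

End MinimalDegree.

(** An element outside [p[x]] has some degree, so that the degree estimate
    excludes it from some power of [P]. That estimate needs [m > 0], which holds because an element
    of [P] of degree 0 lies in [p]. *)
Lemma cap_prime : cap_in B P `<=` polyx p.
Proof.
have [sP PB PMl PMr] := iP; move=> h capPh.
have Ph : P h.
  have : exp_in B P 1 h by apply: capPh.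
  by apply: ideal_mul_min => // a b Pa Bb; apply: PMr.
apply: contrapT => ph.
pose out n := exists u, [/\ P u, polys A n u & ~ polyx p u].
have [n0 out_n0] : exists n, out n.
  have /polyxP[n Ah] : polyx A h by rewrite -BE; apply: PB.
  by exists n, h.
have ex_out : exists n, `[< out n >] by exists n0; apply/asboolP.
case: (ex_minnP ex_out) => -[|m] /asboolP [u [Pu Au pu]] min_m.
  by apply: pu; rewrite (polys0E Au); case: spx.
have m_min v : P v -> polys A m v -> polyx p v.
  move=> Pv Av; apply: contrapT => pv.
  have out_m : out m by exists v.
  by have := min_m m (asboolT out_m); rewrite ltnn.
have [b ub] := polysS_lead Au.
have pb : ~ p b.
  move=> pb; apply: pu.
  have bx : polyx p (b * x ^+ m).
    by apply: (@polys_polyx _ m.+1); apply: polys_monomial.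
  apply: (subgroup_congr spx _ bx); apply: m_min; last by case: ub.
  by apply: subgroupB => //; apply: pxP.
have m_gt0 : (0 < m)%N.
  rewrite lt0n; apply/eqP => m0; apply: pb; rewrite m0 in ub.
  case: ub => Ab /polys0E /eqP; rewrite subr_eq0 mulr1 => /eqP ub; split=> //.
  by rewrite /= -ub.
have leads_p : ~ leads m `<=` p by move=> lp; apply/pb/lp; exists u.
have /polyxP[n Ah] : polyx A h by rewrite -BE; apply: PB.
apply: ph; apply: (exp_degree m_gt0 m_min leads_p (k := n) (h := h)) => //.
  exact: capPh.
by rewrite subrr; case: spx.
Qed.

End PrimeOver.
End DiffPoly.

(** * Iterated differential polynomials *)

Section Tower.
Variables (R S : nzRingType) (iota : {rmorphism R -> S}) (n : nat).
Variables (x : 'I_n -> S) (delta : 'I_n -> S -> S).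
Local Notation T := (tower iota x).

Lemma subring_closedP (X : set S) : GRing.subring_closed [in X] <-> subring X.
Proof.
split=> [[X1 XB XM]|[[X0 XB] X1 XM]].
  have inX a : X a <-> a \in [in X] by rewrite inE.
  split=> [||a b /inX Xa /inX Xb]; [|exact/inX|exact/inX/XM].
  split=> [|a b /inX Xa /inX Xb]; last exact/inX/XB.
  by apply/inX; rewrite -(subrr 1); apply: XB.
by split=> [|a b|a b]; rewrite !inE //; [apply: XB|apply: XM].
Qed.

Lemma subring_tower j : subring (T j).
Proof.
split=> [|A [/subring_closedP[_ A1 _] _]//|a b Ta Tb A gA].
  split=> [A [/subring_closedP[[]]] //|a b Ta Tb A gA].
  have [/subring_closedP[sA _ _] _] := gA.
  by apply: subgroupB => //; [apply: Ta|apply: Tb].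
have [/subring_closedP[_ _ AM] _] := gA.
by apply: AM; [apply: Ta|apply: Tb].
Qed.

Lemma tower_min j (X : set S) : subring X -> range iota `<=` X ->
  (forall k : 'I_n, (k < j)%N -> X (x k)) -> T j `<=` X.
Proof.
move=> sX iX xX u; apply; split; first exact/subring_closedP.
by move=> y [/iX //|[k kj <-]]; apply: xX.
Qed.

Lemma iota_tower j r : T j (iota r).
Proof. by move=> A [_ gA]; apply: gA; left; exists r. Qed.

Lemma x_tower j (k : 'I_n) : (k < j)%N -> T j (x k).
Proof. by move=> kj A [_ gA]; apply: gA; right; exists k. Qed.

Lemma tower_sub j k : (j <= k)%N -> T j `<=` T k.
Proof.
move=> jk; apply: tower_min; first exact: subring_tower.
  by move=> _ [r _ <-]; apply: iota_tower.
by move=> i ij; apply: x_tower; lia.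
Qed.

Lemma tower0 : T 0 = range iota.
Proof.
apply/seteqP; split; last by move=> _ [r _ <-]; apply: iota_tower.
apply: tower_min => //; split=> [||_ _ [r _ <-] [s _ <-]].
- split=> [|_ _ [r _ <-] [s _ <-]]; first by exists 0; rewrite ?rmorph0.
  by exists (r - s); rewrite ?rmorphB.
- by exists 1; rewrite ?rmorph1.
- by exists (r * s); rewrite ?rmorphM.
Qed.

Hypothesis SE : iter_diff_poly_ring iota x delta.
Hypothesis delta_R : forall i : 'I_n, delta i @` range iota `<=` range iota.
Hypothesis delta_x : forall i j : 'I_n, (j < i)%N -> T j.+1 (delta i (x j)).

Lemma delta_iota (i : 'I_n) r : exists s, delta i (iota r) = iota s.
Proof.
have [|s _ <-] := @delta_R i (delta i (iota r)); last by exists s.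
by exists (iota r) => //; exists r.
Qed.

(** The elements of [T j] mapped into [T j] form a subring that contains the
    generators of [T j]. *)
Lemma derivation_tower (i : 'I_n) j : (j <= i)%N -> derivation_on (T j) (delta i).
Proof.
move=> ji; have [_ diffS _] := SE; have [di _ _ _] := diffS i.
have sTj := subring_tower j; have sTi := subring_tower i.
have ij := tower_sub ji; have [dT dD dM] := di.
split=> [|a b Ta Tb|a b Ta Tb]; [|exact: (dD _ _ (ij _ Ta) (ij _ Tb))|exact: (dM _ _ (ij _ Ta) (ij _ Tb))].
suff sub : T j `<=` [set a | T j a /\ T j (delta i a)] by move=> a /sub [].
apply: tower_min.
- have [sgj Tj1 TjM] := sTj.
  split=> [||a b [Ta da] [Tb db]].
  + split=> [|a b [Ta da] [Tb db]] /=.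
      by rewrite (derivation0 sTi di); case: sgj.
    rewrite (derivationB sTi di (ij _ Ta) (ij _ Tb)).
    exact: (conj (subgroupB sgj Ta Tb) (subgroupB sgj da db)).
  + by rewrite /= (derivation1 sTi di); case: sgj.
  + split; first exact: TjM.
    rewrite (dM _ _ (ij _ Ta) (ij _ Tb)).
    exact: (subgroupD sgj (TjM _ _ da Tb) (TjM _ _ Ta db)).
- move=> _ [r _ <-]; split; first exact: iota_tower.
  by have [s ->] := delta_iota i r; apply: iota_tower.
- move=> k kj; split; first exact: x_tower.
  by apply: (tower_sub kj); apply: delta_x; lia.
Qed.

Hypothesis tfR : torsion_free R.
Hypothesis delta_simple : forall J : set R, ideal J ->
  (forall i : 'I_n, delta i @` (iota @` J) `<=` iota @` J) ->
  J = [set 0] \/ J = setT.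

(** The ideal [m R] is stable and, [R] being torsion free, nonzero. *)
Lemma tower_natr_inv j m : exists2 u, T j u & u * m.+1%:R = 1.
Proof.
pose J := [set r *+ m.+1 | r in [set: R]].
have iJ : ideal J.
  split; split; try by exists 0; rewrite ?mul0rn.
  - by move=> _ _ [r _ <-] [s _ <-]; exists (r + s); rewrite ?mulrnDl.
  - by move=> s _ [r _ <-]; exists (s * r); rewrite ?mulrnAr.
  - by move=> _ _ [r _ <-] [s _ <-]; exists (r + s); rewrite ?mulrnDl.
  - by move=> s _ [r _ <-]; exists (r * s); rewrite ?mulrnAl.
have [i _ [_ [_ [r _ <-] <-] <-]|J0|J1] := delta_simple iJ.
- have [s dr] := delta_iota i r.
  exists (s *+ m.+1); first by exists s.
  rewrite !rmorphMn /= -dr.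
  have di := derivation_tower (leq0n i); have sT := subring_tower 0.
  have [sgT _ _] := sT.
  elim: m.+1 => [|k IHk]; first by rewrite (derivation0 sT di).
  rewrite !mulrS IHk; case: di => _ -> //; first exact: iota_tower.
  exact: (subgroupMn k sgT (@iota_tower 0 r)).
- have : J (1 *+ m.+1) by exists 1.
  by rewrite J0 => /tfR /eqP; rewrite oner_eq0.
have [r _ rm] : J 1 by rewrite J1.
exists (iota r); first exact: iota_tower.
by rewrite mulr_natr -rmorphMn rm rmorph1.
Qed.

Definition stable_from j (I : set S) := forall i : 'I_n, (j <= i)%N -> stable (delta i) I.

Lemma itercap_tower j I : (j <= n)%N -> ideal_in (T j) I -> ~ I 1 ->
  stable_from j I -> itercap_in (T j) I j `<=` [set 0].
Proof.
elim: j I => [|j IHj] I jn iI I1 dI.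
  pose J := iota @^-1` I; have [sI IT IMl IMr] := iI.
  have iJ : ideal J.
    split; split; rewrite /J /= ?rmorph0; try by case: sI.
    - by move=> a b Ia Ib /=; rewrite rmorphD; apply: subgroupD.
    - by move=> r a Ia /=; rewrite rmorphM; apply: IMl => //; apply: iota_tower.
    - by move=> a b Ia Ib /=; rewrite rmorphD; apply: subgroupD.
    - by move=> r a Ia /=; rewrite rmorphM; apply: IMr => //; apply: iota_tower.
  have [i _ [_ [r Jr <-] <-]|J0|J1] := delta_simple iJ.
  - have [s dr] := delta_iota i r; exists s; last by rewrite dr.
    by rewrite /J /= -dr; apply: dI.
  - move=> u Iu; have := IT u Iu; rewrite tower0 => -[r _ ru].
    have : J r by rewrite /J /= ru.
    by rewrite J0 => /= r0; rewrite -ru r0 rmorph0.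
  - have : J 1 by rewrite J1.
    by rewrite /J /= rmorph1.
pose i0 := Ordinal jn; have [_ /(_ i0) diffT _] := SE.
have [sA sB] := (subring_tower j, subring_tower j.+1).
pose D := [set delta i | i in [set i : 'I_n | (j < i)%N]].
have [|P [prP IP DP]] := exists_stable_prime sB (tower_natr_inv j.+1) (D := D) _ iI I1.
  by move=> _ [i ji <-]; split; [apply: derivation_tower|apply: dI].
have ip := ideal_contraction sA diffT prP.
have dp := stable_contraction sA diffT prP.
have capP := cap_prime sA sB diffT prP.
have pI : stable_from j (P `&` T j).
  move=> i; rewrite leq_eqVlt => /orP[/eqP ji|ji] a [Pa Ta].
    have -> : i = i0 by apply: val_inj.
    by apply: dp.
  split; first by apply: DP => //; exists i.
  by case: (derivation_tower (ltnW ji)) => + _ _; apply.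
have p1 : ~ (P `&` T j) 1 by case=> P1 _; case: prP.
rewrite /itercap_in iterSr => u Hu.
have IPp : cap_in (T j.+1) I `<=` polyx (x i0) (P `&` T j).
  by move=> v Iv; apply: capP => k _; apply: (exp_inS IP); apply: Iv.
have [f fp <-] := itercap_polyx sA diffT ip dp (itercap_inS IPp Hu).
have -> : f = 0.
  by apply/polyP => k; rewrite coef0; apply: (IHj _ (ltnW jn) ip p1 pI); apply: fp.
by rewrite horner0.
Qed.

End Tower.

Theorem theorem3p5 (R S : nzRingType) (iota : {rmorphism R -> S}) (n : nat)
    (x : 'I_n -> S) (delta : 'I_n -> S -> S)
    (noethR : noetherian R) (primeR : prime_ring R) (tfR : torsion_free R)
    (n_gt0 : (0 < n)%N)
    (SE : iter_diff_poly_ring iota x delta)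
    (delta_R : forall i : 'I_n, delta i @` range iota `<=` range iota)
    (delta_x : forall i j : 'I_n, (j < i)%N ->
       tower iota x j.+1 (delta i (x j)))
    (delta_simple : forall J : set R, ideal J ->
       (forall i : 'I_n, delta i @` (iota @` J) `<=` iota @` J) ->
       J = [set 0] \/ J = setT) :
  forall I : set S, proper_ideal I -> ideal_itercap I n = [set 0].
Proof.
move=> I [[[I0 ID IMl] [_ _ IMr]] IT].
have [_ _ Tn] := SE; have sT := subring_tower iota x n.
have iI : ideal_in (tower iota x n) I.
  rewrite Tn; split=> // [|r a _ Ia|r a _ Ia]; [|exact: IMl|exact: IMr].
  by split=> // a b Ia Ib; apply: ID => //; rewrite -mulN1r; apply: IMl.
have I1 : ~ I 1.
  by move=> I1; apply: IT; apply/seteqP; split=> // r _; rewrite -[r]mulr1; apply: IMl.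
have itE : ideal_itercap I n = itercap_in (tower iota x n) I n by rewrite Tn.
apply/seteqP; split; rewrite itE.
  apply: (itercap_tower SE delta_R delta_x tfR delta_simple) => //.
  by move=> i; rewrite leqNgt ltn_ord.
by move=> _ ->; have [[]] := ideal_itercap_in n sT iI.
Qed.
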